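(* Let $\alpha\in(0,1/2)$ be irrational. Then $\alpha=1/\varphi^2$, where $\varphi=(1+\sqrt5)/2$ is the golden ratio, if and only if the minimum abelian period of every nonempty factor of slope $\alpha$ belongs to $\{q_k: k\ge0\}$, the set of denominators of the convergents of $\alpha$.
   Context: Write $\alpha=[0;a_1,a_2,\ldots]$ with positive integers $a_i$; $q_0=1$, $q_1=a_1$, $q_k=a_kq_{k-1}+q_{k-2}$ for $k\ge2$ (with $q_{-1}=0$, which is not included in the set). Sturmian words: identify the circle $\mathbb{T}$ with $[0,1)$, let $R(\rho)=\{\rho+\alpha\}$, and fix one of the conventions $I_0=[0,1-\alpha)$, $I_1=[1-\alpha,1)$ or $I_0=(0,1-\alpha]$, $I_1=(1-\alpha,1]$. For $\rho\in\mathbb{T}$ the Sturmian word $\mathbf{s}_{\rho,\alpha}$ has $n$-th letter $0$ if $R^n(\rho)\in I_0$ and $1$ otherwise. All these words (all $\rho$, both conventions) have the same set $\mathcal{L}_\alpha$ of finite factors; its elements are the factors of slope $\alpha$. Abelian periods: the Parikh vector of a binary word $u$ is $(|u|_0,|u|_1)$; $P$ is contained in $Q$ if $P\le Q$ componentwise and $P\ne Q$. An abelian decomposition of $w$ is $w=u_0u_1\cdots u_{n-1}u_n$, $n\ge2$, with $u_1,\dots,u_{n-1}$ having a common Parikh vector $P$ and the Parikh vectors of $u_0,u_n$ contained in $P$; the common length of $u_1,\ldots,u_{n-1}$ is an abelian period of $w$; the minimum abelian period is the least one. *)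

(* Defs.v *)
From Stdlib Require Import Reals.
From mathcomp Require Import all_boot.
Set Implicit Arguments. Unset Strict Implicit. Unset Printing Implicit Defensive.
Open Scope R_scope.

Definition fracR (x : R) : R := x - IZR (Int_part x).

Definition irrational (x : R) : Prop :=
  ~ exists (p q : Z), q <> 0%Z /\ x = IZR p / IZR q.

Definition golden_ratio : R := (1 + sqrt 5) / 2.

Fixpoint cf_rem (alpha : R) (k : nat) : R :=
  match k with
  | O => alpha
  | S k' => fracR (1 / cf_rem alpha k')
  end.

(** partial quotients: alpha = [0; a_1, a_2, ...], a_(k+1) = floor (1 / cf_rem alpha k).
    (pq alpha 0 is an unused dummy equal to 0.) *)
Definition pq (alpha : R) (k : nat) : nat :=
  match k with
  | O => 0%nat
  | S k' => Z.to_nat (Int_part (1 / cf_rem alpha k'))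
  end.

Fixpoint q_pair (alpha : R) (k : nat) : nat * nat :=
  (* returns (q_k, q_(k-1)) with q_(-1) = 0 *)
  match k with
  | O => (1%nat, 0%nat)
  | S k' => let (a, b) := q_pair alpha k' in ((pq alpha (S k') * a + b)%nat, a)
  end.
Definition qden (alpha : R) (k : nat) : nat := fst (q_pair alpha k).

(** Sturmian words. conv = false : I_0 = [0, 1-alpha), I_1 = [1-alpha, 1);
    conv = true : I_0 = (0, 1-alpha], I_1 = (1-alpha, 1] (with 1 identified with 0). *)
Definition in_I0 (alpha : R) (conv : bool) (x : R) : Prop :=
  if conv then 0 < x /\ x <= 1 - alpha else 0 <= x /\ x < 1 - alpha.

(** n-th letter of s_{rho,alpha} is 0 (false) iff R^n(rho) = {rho + n alpha} in I_0. *)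
Definition sturm_letter (alpha rho : R) (conv : bool) (n : nat) (b : bool) : Prop :=
  (b = false <-> in_I0 alpha conv (fracR (rho + INR n * alpha))).

Definition factor_of_slope (alpha : R) (w : seq bool) : Prop :=
  exists (rho : R) (conv : bool) (m : nat),
    0 <= rho < 1 /\
    forall i : nat, (i < size w)%nat ->
      sturm_letter alpha rho conv (m + i) (nth false w i).

Definition parikh (u : seq bool) : nat * nat := (count negb u, count id u).

Definition parikh_contained (P Q : nat * nat) : Prop :=
  (P.1 <= Q.1)%nat /\ (P.2 <= Q.2)%nat /\ P <> Q.

Definition abelian_period (w : seq bool) (p : nat) : Prop :=
  exists (u0 : seq bool) (mid : seq (seq bool)) (un : seq bool) (P : nat * nat),
    (0 < size mid)%nat /\
    w = u0 ++ flatten mid ++ un /\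
    (forall u, u \in mid -> parikh u = P) /\
    parikh_contained (parikh u0) P /\
    parikh_contained (parikh un) P /\
    (forall u, u \in mid -> size u = p).

Definition min_abelian_period (w : seq bool) (p : nat) : Prop :=
  abelian_period w p /\ forall p', abelian_period w p' -> (p <= p')%nat.

(* Main.v *)
(** A factor of slope [alpha] stays in a strip of height 1: for some [y], the number of
    ones among its first [i] letters lies in [[y + i alpha - 1, y + i alpha]].  Hence
    [e] consecutive blocks of length [p] with [c] ones each force
    [e |p alpha - c| <= 1], which bounds the length of a word of abelian period [p].
    Conversely, if [p alpha] is close to an integer and the head starts at a suitable
    point of the circle, then [p] is an abelian period.

    Golden slope: for [q_k < p < q_(k+1)] the distance of [p alpha] to the integers is
    so much larger than that of [q_k alpha] that a word of abelian period [p] is short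
    enough to have the abelian period [q_k] (or [q_(k-2)], if it has not even length
    [2 q_k]).  Words of length at most 15 are checked by computation.

    Other slopes: if [a_k >= 2] with [k >= 2], then [2 q_(k-1)] is not a denominator of a
    convergent, and it is the abelian period of a factor too long to have any of the
    abelian periods [q_0, ..., q_(k-1)].  If [a_1 >= 3], the factor [01] has minimum
    abelian period 2. *)

Require Import Defs.
From Stdlib Require Import Reals Lra Lia ZArith.
From mathcomp Require Import all_boot zify.
Set Implicit Arguments. Unset Strict Implicit. Unset Printing Implicit Defensive.
Open Scope R_scope.

(** * Parikh vectors and a decision procedure for abelian periods *)

Lemma count_negb (u : seq bool) : (count negb u + count id u = size u)%N.
Proof. by rewrite addnC; apply: (count_predC id). Qed.

Lemma parikh_eq (u : seq bool) (P : nat * nat) :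
  parikh u = P <-> size u = (P.1 + P.2)%N /\ count id u = P.2.
Proof.
case: P => z c; rewrite /parikh /=; have H := count_negb u; split=> [[<- <-]|[]].
  by split=> //; rewrite H.
by move=> Hs Hc; congr pair => //; lia.
Qed.

Lemma parikh_containedE (u : seq bool) (P : nat * nat) :
  parikh_contained (parikh u) P <->
  [/\ (size u < P.1 + P.2)%N, (count id u <= P.2)%N & (size u <= P.1 + count id u)%N].
Proof.
have H := count_negb u; case: P => z c; rewrite /parikh_contained /=; split.
  move=> [H1 [H2 H3]]; split=> //; last by lia.
  rewrite ltn_neqAle; apply/andP; split; last by lia.
  by apply/eqP => E; apply: H3; congr pair; lia.
by case=> H1 H2 H3; split; [lia | split=> // -[]]; lia.
Qed.

(* [blocks fuel p c w]: [w] is a sequence of length-[p] words with [c] ones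
   followed by a word contained in their Parikh vector; the [if]s make
   [vm_compute] stop at the first bad block. *)
Fixpoint blocks (fuel p c : nat) (w : seq bool) : bool :=
  if (size w < p)%N then
    (count id w <= c)%N && (size w + c <= p + count id w)%N
  else if fuel is n.+1 then
    if count id (take p w) == c then blocks n p c (drop p w) else false
  else false.

(** The Parikh vector is dictated by the block that follows the head, so a period can be tested by
    trying all head lengths. The first [if] ensures at least one full block. *)
Definition has_head (p : nat) (w : seq bool) (h : nat) : bool :=
  if (h + p <= size w)%N then
    let c := count id (take p (drop h w)) in
    if (count id (take h w) <= c)%N && (h + c <= p + count id (take h w))%N
    then blocks (size w) p c (drop h w) else false
  else false.

Definition abperiodb (w : seq bool) (p : nat) : bool := has (has_head p w) (iota 0 p).

Lemma blocksP (p c n : nat) (w : seq bool) : (0 < p)%N -> (size w <= n)%N ->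
  reflect (exists mid un, [/\ w = flatten mid ++ un,
      forall u, u \in mid -> size u = p /\ count id u = c, (size un < p)%N,
      (count id un <= c)%N & (size un + c <= p + count id un)%N])
    (blocks n p c w).
Proof.
move=> p0; elim: n w => [|n IH] w Hw /=; case: ltnP => Hp.
- apply: (iffP andP) => [[H1 H2]|[mid [un [E Hm Hu H1 H2]]]].
    by exists [::], w; split.
  case: mid E Hm => [|u mid] E Hm; first by rewrite E.
  by have [Hs _] := Hm u (mem_head _ _); move: Hp; rewrite E /= !size_cat Hs; lia.
- by exfalso; lia.
- apply: (iffP andP) => [[H1 H2]|[mid [un [E Hm Hu H1 H2]]]].
    by exists [::], w; split.
  case: mid E Hm => [|u mid] E Hm; first by rewrite E.
  by have [Hs _] := Hm u (mem_head _ _); move: Hp; rewrite E /= !size_cat Hs; lia.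
case: eqP => Hc; last first.
  apply: ReflectF => -[mid [un [E Hm Hu H1 H2]]].
  case: mid E Hm => [|u mid] E Hm; first by move: Hp; rewrite E /=; lia.
  have [Hs Hcu] := Hm u (mem_head _ _); apply: Hc.
  by rewrite E /= -catA take_size_cat.
apply: (iffP (IH _ _)); first by rewrite size_drop; lia.
- move=> [mid [un [E Hm Hu H1 H2]]]; exists (take p w :: mid), un; split=> //.
    by rewrite /= -catA -E cat_take_drop.
  move=> u; rewrite in_cons => /orP[/eqP->|]; last exact: Hm.
  by split=> //; rewrite size_takel.
- move=> [mid [un [E Hm Hu H1 H2]]].
  case: mid E Hm => [|u mid] E Hm; first by move: Hp; rewrite E /=; lia.
  have [Hs Hcu] := Hm u (mem_head _ _).
  exists mid, un; split=> //; first by rewrite E /= -catA drop_size_cat.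
  by move=> v Hv; apply: Hm; rewrite in_cons Hv orbT.
Qed.

Lemma abperiodP (w : seq bool) (p : nat) : reflect (abelian_period w p) (abperiodb w p).
Proof.
apply: (iffP hasP) => [[h]|[u0 [mid [un [P [Hm [E [HP [H0 [Hn Hs]]]]]]]]]].
  rewrite mem_iota add0n => /andP[_ hp]; rewrite /has_head.
  case: ifP => // Hhp; case: ifP => // /andP[H1 H2].
  have p0 : (0 < p)%N by lia.
  have sd : (size (drop h w) <= size w)%N by rewrite size_drop; lia.
  move/(blocksP _ p0 sd) => [mid [un [E Hm Hu H3 H4]]].
  have cp : (count id (take p (drop h w)) <= p)%N.
    by apply: leq_trans (count_size _ _) _; rewrite size_take; case: ltnP; lia.
  move: (count id (take p (drop h w))) cp H1 H2 E Hm H3 H4 => c cp H1 H2 E Hm H3 H4.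
  exists (take h w), mid, un, ((p - c)%N, c).
  have sh : size (take h w) = h by rewrite size_takel //; lia.
  split.
    case: mid E Hm => // E _; exfalso.
    by have := size_drop h w; rewrite E /=; lia.
  split; first by rewrite -E cat_take_drop.
  split.
    by move=> u /Hm [us uc]; apply/parikh_eq; split=> /=; rewrite ?subnK.
  split; first by apply/parikh_containedE; split=> /=; lia.
  split; first by apply/parikh_containedE; split=> /=; lia.
  by move=> u /Hm [].
case: P HP H0 Hn => z c HP /parikh_containedE [/= A1 A2 A3] /parikh_containedE [/= B1 B2 B3].
have [u [mid' Em]] : exists u mid', mid = u :: mid'.
  by case: (mid) Hm => // u mid' _; exists u, mid'.
have Hu : u \in mid by rewrite Em mem_head.
have [/= us uc] := (parikh_eq _ _).1 (HP u Hu).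
have Ep : p = (z + c)%N by rewrite -us (Hs u Hu).
have Ed : drop (size u0) w = flatten mid ++ un by rewrite E drop_size_cat.
exists (size u0); first by rewrite mem_iota; lia.
have Ec : count id (take p (drop (size u0) w)) = c.
  by rewrite Ed Em /= -catA take_size_cat // Hs.
have Et : take (size u0) w = u0 by rewrite E take_size_cat.
rewrite /has_head Ec Et.
have -> : (size u0 + p <= size w)%N by rewrite E Em /= !size_cat (Hs u Hu); lia.
rewrite A2 /=.
have -> : (size u0 + c <= p + count id u0)%N by lia.
have p0 : (0 < p)%N by lia.
apply/blocksP => //; first by rewrite size_drop; lia.
exists mid, un; split=> //; try lia.
by move=> v Hv; split; [exact: Hs | have [] := (parikh_eq _ _).1 (HP v Hv)].
Qed.

Lemma abelian_period_size (w : seq bool) : w <> [::] -> abelian_period w (size w).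
Proof.
move=> w0; have Hs : (0 < size w)%N by case: (w) w0.
have H0 : parikh_contained (parikh [::]) (parikh w).
  by apply/parikh_containedE; rewrite /= (count_negb w); split=> //; lia.
exists [::], [:: w], [::], (parikh w); rewrite /= !cats0; do ![split=> //] => u;
  by rewrite inE => /eqP->.
Qed.

Lemma min_abelian_period_exists (w : seq bool) :
  w <> [::] -> exists p, min_abelian_period w p.
Proof.
move=> w0; have ex : exists p, abperiodb w p.
  by exists (size w); apply/abperiodP; apply: abelian_period_size.
case: (ex_minnP ex) => p /abperiodP Hp Hmin; exists p; split=> // p' /abperiodP.
exact: Hmin.
Qed.

Definition ones (w : seq bool) (i : nat) : nat := count id (take i w).

Lemma onesS (w : seq bool) (i : nat) : (i < size w)%N ->
  ones w i.+1 = (ones w i + nth false w i)%N.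
Proof.
move=> Hi; rewrite /ones (take_nth false) // -cats1 count_cat /=; lia.
Qed.

Lemma ones_drop (w : seq bool) (i j : nat) : 
  count id (take j (drop i w)) = (ones w (i + j) - ones w i)%N.
Proof.
by rewrite /ones takeD count_cat addKn.
Qed.

Lemma leq_ones (w : seq bool) (i j : nat) : (i <= j)%N -> (ones w i <= ones w j)%N.
Proof. by move=> /subnKC <-; rewrite /ones takeD count_cat leq_addr. Qed.

Lemma blocks_of_ones (w : seq bool) (p c e n : nat) : (0 < p)%N -> (size w <= n)%N ->
  (e * p <= size w < e.+1 * p)%N ->
  (forall j, (j <= e)%N -> ones w (j * p) = (j * c)%N) ->
  (ones w (size w) <= e.+1 * c)%N ->
  (size w + e.+1 * c <= e.+1 * p + ones w (size w))%N ->
  blocks n p c w.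
Proof.
move=> p0; elim: e w n => [|e IH] w n Hn /andP[Hl Hu] Hj H1 H2.
  have Hw : (size w < p)%N by lia.
  move: H1 H2; rewrite /ones take_size => H1 H2.
  by case: n {Hn} => [|n] /=; rewrite Hw; apply/andP; lia.
case: n Hn => [|n] Hn /=; first by lia.
have -> : (size w < p)%N = false by lia.
have := Hj 1%N isT; rewrite !mul1n {1}/ones => ->; rewrite eqxx.
have Ec : ones w p = c by have := Hj 1%N isT; rewrite !mul1n.
have Eo i : ones (drop p w) i = (ones w (p + i) - c)%N.
  by rewrite {1}/ones ones_drop Ec.
have sE : (p + size (drop p w) = size w)%N by rewrite size_drop; lia.
apply: IH.
- by lia.
- by lia.
- by move=> j jn; rewrite Eo; have := Hj j.+1 jn; rewrite !mulSn; lia.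
- by rewrite Eo sE; lia.
- by rewrite Eo sE; have := leq_ones w (leq_addr (size (drop p w)) p); rewrite sE Ec; lia.
Qed.

(** The conditions bear on prefix counts, which are what the strip controls. The last two bound the
    ones and zeros of the tail by those of one further block. *)
Lemma abelian_period_of_ones (w : seq bool) (p c h e : nat) :
  (0 < e)%N -> (h < p)%N -> (h + e * p <= size w < h + e.+1 * p)%N ->
  (forall j, (j <= e)%N -> ones w (h + j * p) = (ones w h + j * c)%N) ->
  (ones w h <= c)%N -> (h + c <= p + ones w h)%N ->
  (ones w (size w) <= ones w h + e.+1 * c)%N ->
  (size w + ones w h + e.+1 * c <= h + e.+1 * p + ones w (size w))%N ->
  abelian_period w p.
Proof.
move=> e0 hp /andP[Hl Hu] Hj A1 A2 B1 B2; apply/abperiodP; apply/hasP.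
exists h; first by rewrite mem_iota; lia.
rewrite /has_head.
have -> : (h + p <= size w)%N by nia.
have -> : count id (take p (drop h w)) = c.
  by rewrite ones_drop; have := Hj 1%N e0; rewrite !mul1n; lia.
rewrite -/(ones w h) A1 A2 /=.
have Eo i : ones (drop h w) i = (ones w (h + i) - ones w h)%N by rewrite {1}/ones ones_drop.
have sE : (h + size (drop h w) = size w)%N by rewrite size_drop; nia.
have Hm : (ones w h <= ones w (size w))%N by apply: leq_ones; lia.
apply: (@blocks_of_ones _ _ _ e); rewrite ?Eo ?sE; try lia.
by move=> j je; rewrite Eo Hj //; lia.
Qed.

(** * Words in a strip *)

(** Both bounds are closed so that the two coding conventions are covered at once. *)
Definition near_line (alpha y : R) (w : seq bool) : Prop :=
  forall i, (i <= size w)%N -> y + INR i * alpha - 1 <= INR (ones w i) <= y + INR i * alpha.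

Lemma fracR_bounds (x : R) : 0 <= fracR x < 1.
Proof. rewrite /fracR; have := base_Int_part x; lra. Qed.

Lemma Int_part_unique (x r : R) (n : Z) : x = r + IZR n -> 0 <= r < 1 -> Int_part x = n.
Proof.
move=> E Hr; have [H1 H2] := base_Int_part x.
have A1 : IZR (Int_part x) < IZR (n + 1) by rewrite plus_IZR; lra.
have A2 : IZR n < IZR (Int_part x + 1) by rewrite plus_IZR; lra.
by move/lt_IZR in A1; move/lt_IZR in A2; lia.
Qed.

Lemma fracR_unique (x r : R) (n : Z) : x = r + IZR n -> 0 <= r < 1 -> fracR x = r.
Proof. by move=> E Hr; rewrite /fracR (Int_part_unique E Hr); lra. Qed.

Lemma fracR_shift (x : R) : exists n : Z, x = fracR x + IZR n.
Proof. by exists (Int_part x); rewrite /fracR; lra. Qed.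

(** Invariant: [y + i alpha - ones w i] is the current orbit point, taken in [0, 1), or in (0, 1] if
    [conv] is true. The next letter is one exactly when adding [alpha] forces a subtraction of 1 to
    stay there. *)
Lemma sturm_near_line (alpha rho : R) (conv : bool) (m : nat) (w : seq bool) (y : R) (n0 : Z) :
  0 < alpha < 1 ->
  rho + INR m * alpha = y + IZR n0 ->
  (if conv then 0 < y <= 1 else 0 <= y < 1) ->
  (forall i : nat, (i < size w)%N -> sturm_letter alpha rho conv (m + i) (nth false w i)) ->
  near_line alpha y w.
Proof.
move=> Ha Ey Hy Hw i Hi.
suff H : let r := y + INR i * alpha - INR (ones w i) in
    if conv then 0 < r <= 1 else 0 <= r < 1.
  by move: H; case: (conv) => /=; lra.
elim: i Hi => [|i IH] Hi; first by rewrite /ones take0 /=; case: (conv) Hy => /=; lra.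
have {}IH := IH (ltnW Hi).
have := Hw i Hi; rewrite onesS // plus_INR S_INR /sturm_letter plus_INR.
have Ez : rho + (INR m + INR i) * alpha =
    (y + INR i * alpha - INR (ones w i)) + IZR (n0 + Z.of_nat (ones w i)).
  by rewrite plus_IZR -INR_IZR_INZ; lra.
move: IH Ez; set r := y + _ - _; set z := rho + _; cbv zeta => IH Ez.
have -> : y + (INR i + 1) * alpha - (INR (ones w i) + INR (nth false w i)) =
  r + alpha - INR (nth false w i) by rewrite /r; lra.
case: conv Hy Hw IH => Hy Hw IH; rewrite /in_I0.
- case: (Rle_lt_or_eq_dec r 1 (proj2 IH)) => [r1|r1].
    rewrite (fracR_unique Ez); last by lra.
    case: (nth false w i) => /= -[H1 H2]; last by have := H1 erefl; lra.
    by case: (Rle_dec r (1 - alpha)) => H; [have := H2 (conj (proj1 IH) H) | lra].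
  (* The point 1 has fractional part 0, which lies outside (0, 1 - alpha]; so the letter is one, as
     it should be. *)
  have Ez' : z = 0 + IZR (n0 + Z.of_nat (ones w i) + 1) by rewrite plus_IZR; lra.
  rewrite (fracR_unique Ez'); last by lra.
  by case: (nth false w i) => /= -[H1 H2]; [lra | have := H1 erefl; lra].
- rewrite (fracR_unique Ez); last by lra.
  case: (nth false w i) => /= -[H1 H2]; last by have := H1 erefl; lra.
  by case: (Rlt_dec r (1 - alpha)) => H; [have := H2 (conj (proj1 IH) H) | lra].
Qed.

Lemma factor_near_line (alpha : R) (w : seq bool) : 0 < alpha < 1 ->
  factor_of_slope alpha w -> exists y, near_line alpha y w.
Proof.
move=> Ha [rho [conv [m [_ Hw]]]].
have [n En] := fracR_shift (rho + INR m * alpha).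
have Hf := fracR_bounds (rho + INR m * alpha).
case: conv Hw => Hw.
  case: (Rle_lt_or_eq_dec _ _ (proj1 Hf)) => H0.
    by exists (fracR (rho + INR m * alpha)); apply: (sturm_near_line Ha En _ Hw); lra.
  have E1 : rho + INR m * alpha = 1 + IZR (n - 1) by rewrite minus_IZR; lra.
  by exists 1; apply: (sturm_near_line Ha E1 _ Hw); lra.
by exists (fracR (rho + INR m * alpha)); apply: (sturm_near_line Ha En _ Hw); lra.
Qed.

Lemma sturm_word (alpha rho : R) (L : nat) : 0 < alpha < 1 -> 0 <= rho < 1 ->
  exists w, [/\ size w = L, factor_of_slope alpha w & near_line alpha rho w].
Proof.
move=> Ha Hr.
pose l i : bool := if Rlt_dec (fracR (rho + INR i * alpha)) (1 - alpha) then false else true.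
have Hw i : (i < size (mkseq l L))%N ->
    sturm_letter alpha rho false (0 + i) (nth false (mkseq l L) i).
  rewrite size_mkseq => Hi; rewrite nth_mkseq // add0n /sturm_letter /in_I0 /l.
  have := fracR_bounds (rho + INR i * alpha).
  by case: Rlt_dec => /= H1 H2; split=> //; lra.
exists (mkseq l L); split; first by rewrite size_mkseq.
  by exists rho, false, 0%N; split.
have E0 : rho + INR 0 * alpha = rho + IZR 0 by rewrite /=; lra.
exact: (@sturm_near_line alpha rho false 0 _ rho 0 Ha E0 Hr Hw).
Qed.

Lemma near_line_ones (alpha y : R) (w : seq bool) (i : nat) (n : Z) :
  near_line alpha y w -> (i <= size w)%N ->
  IZR n < y + INR i * alpha < IZR n + 1 -> Z.of_nat (ones w i) = n.
Proof.
move=> Hl Hi Hn; have := Hl i Hi; rewrite (INR_IZR_INZ (ones w i)) => H.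
have A1 : IZR (Z.of_nat (ones w i)) < IZR (n + 1) by rewrite plus_IZR; lra.
have A2 : IZR n < IZR (Z.of_nat (ones w i) + 1) by rewrite plus_IZR; lra.
by move/lt_IZR in A1; move/lt_IZR in A2; lia.
Qed.

(* The slack [alpha] gained because head and tail are strictly shorter than [p]
   absorbs the drift [p alpha - P], so only the full blocks constrain [t]. *)
Lemma abelian_period_of_drift (alpha y : R) (w : seq bool) (p h e : nat) (P n : Z) (t : R) :
  near_line alpha y w -> 0 < alpha < 1 ->
  Rabs (INR p * alpha - IZR P) <= alpha -> Rabs (INR p * alpha - IZR P) <= 1 - alpha ->
  (0 < e)%N -> (h < p)%N -> (h + e * p <= size w < h + e.+1 * p)%N ->
  y + INR h * alpha = IZR n + t ->
  0 < t < 1 -> 0 < t + INR e * (INR p * alpha - IZR P) < 1 ->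
  abelian_period w p.
Proof.
move=> Hl Ha Hd1 Hd2 e0 hp /andP[HL HU] En Ht Hte.
set D := INR p * alpha - IZR P in Hd1 Hd2 Hte.
have [D1 D2] : - alpha <= D <= alpha /\ - (1 - alpha) <= D <= 1 - alpha.
  by split; [move: Hd1 | move: Hd2]; rewrite /Rabs; case: Rcase_abs; lra.
(* Modulo 1 the block boundaries sit at [t + j D], between [t] and [t + e D], hence inside (0, 1):
   every block has exactly [P] ones. *)
have Hj j : (j <= e)%N -> Z.of_nat (ones w (h + j * p)) = (n + Z.of_nat j * P)%Z.
  move=> je; apply: (near_line_ones Hl); first by nia.
  rewrite plus_INR mult_INR plus_IZR mult_IZR -INR_IZR_INZ.
  have -> : y + (INR h + INR j * INR p) * alpha = IZR n + INR j * IZR P + (t + INR j * D).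
    by rewrite /D; lra.
  have je' : INR j <= INR e by apply: le_INR; lia.
  have j0 := pos_INR j.
  by case: (Rle_dec 0 D) => H0; split; nra.
have Sh : Z.of_nat (ones w h) = n by have := Hj 0%N isT; rewrite mul0n addn0; lia.
have P0 : (0 <= P)%Z.
  have := Hj 1%N e0; rewrite mul1n => H1.
  by have := leq_ones w (leq_addr p h); lia.
have y01 : 0 <= y <= 1.
  by have := Hl 0%N isT; rewrite /ones take0 /=; lra.
have hp' : INR h + 1 <= INR p by rewrite -S_INR; apply: le_INR; lia.
have h0 := pos_INR h.
pose g := (size w - (h + e * p))%N.
have Eg : size w = (h + e * p + g)%N by rewrite /g; lia.
have gp : (g < p)%N by rewrite /g; nia.
have gp' : INR g + 1 <= INR p by rewrite -S_INR; apply: le_INR; lia.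
have EpZ : INR p * alpha = IZR P + D by rewrite /D; lra.
have Sw := Hl _ (leqnn (size w)).
have Ew : y + INR (size w) * alpha = IZR n + t + INR e * D + INR e * IZR P + INR g * alpha.
  by rewrite Eg !plus_INR mult_INR; nra.
rewrite Ew (INR_IZR_INZ (ones _ _)) in Sw.
set s := ones w (size w) in Sw *.
(* Since [g <= p - 1], [g alpha <= P + D - alpha <= P]; the strict real bound then gives the integer
   bound, written with [+ 1]. The other three bounds are similar. *)
have B1 : (Z.of_nat s < n + Z.of_nat e * P + P + 1)%Z.
  by apply: lt_IZR; rewrite !plus_IZR mult_IZR -(INR_IZR_INZ e); nra.
have B2 : (n + Z.of_nat e * P + P + Z.of_nat g < Z.of_nat s + Z.of_nat p + 1)%Z.
  by apply: lt_IZR; rewrite !plus_IZR mult_IZR -(INR_IZR_INZ e)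
    -(INR_IZR_INZ p) -(INR_IZR_INZ g); nra.
have A1 : (n < P + 1)%Z by apply: lt_IZR; rewrite plus_IZR; nra.
have A2 : (P + Z.of_nat h < n + Z.of_nat p + 1)%Z.
  by apply: lt_IZR; rewrite !plus_IZR -!INR_IZR_INZ; nra.
apply: (@abelian_period_of_ones w p (Z.to_nat P) h e) => //; rewrite -/s; try nia.
by move=> j je; have := Hj j je; nia.
Qed.

(** The strip is applied at both ends of the run of full blocks. The [+ 2] comes from head and tail
    having at most [p - 1] letters each. *)
Lemma abelian_period_drift (alpha y : R) (w : seq bool) (p : nat) :
  near_line alpha y w -> abelian_period w p ->
  exists e c : nat, [/\ (0 < e)%N, (p <= size w)%N, (size w + 2 <= (e + 2) * p)%N &
    INR e * Rabs (INR p * alpha - INR c) <= 1].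
Proof.
move=> Hl [u0 [mid [un [[z c] [Hm [E [HP [H0 [Hn Hs]]]]]]]]].
move: H0 Hn => /parikh_containedE [/= A1 _ _] /parikh_containedE [/= B1 _ _].
have Hu u : u \in mid -> size u = (z + c)%N /\ count id u = c.
  by move=> /HP/parikh_eq.
have Ep : p = (z + c)%N.
  case: (mid) Hm Hs Hu => // u ? _ Hs Hu.
  by rewrite -(Hs u (mem_head _ _)); have [] := Hu u (mem_head _ _).
have [Hsz Hc] : size (flatten mid) = (size mid * p)%N /\ count id (flatten mid) = (size mid * c)%N.
  elim: (mid) Hu => [|u m IH] Hu //=.
  have [Hus Huc] := Hu u (mem_head _ _).
  have [|I1 I2] := IH; first by move=> v Hv; apply: Hu; rewrite in_cons Hv orbT.
  by rewrite size_cat count_cat I1 I2 Hus Huc Ep !mulSn.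
have Sw : size w = (size u0 + size mid * p + size un)%N by rewrite E !size_cat Hsz; lia.
exists (size mid), c; split=> //; try nia.
set e := size mid in Hm Hsz Hc Sw *; set h := size u0 in A1 Sw.
have O1 : ones w h = count id u0 by rewrite /ones E take_size_cat.
have O2 : ones w (h + e * p) = (count id u0 + e * c)%N.
  by rewrite /ones E catA take_size_cat ?count_cat ?Hc // size_cat Hsz.
have := Hl h; rewrite O1 => /(_ _) X1; have {}X1 := X1 ltac:(lia).
have := Hl (h + e * p)%N; rewrite O2 => /(_ _) X2; have {}X2 := X2 ltac:(lia).
move: X2; rewrite !plus_INR !mult_INR => X2.
have e0 := pos_INR e.
rewrite -{1}(Rabs_pos_eq _ e0) -Rabs_mult; apply: Rabs_le; nra.
Qed.

(** * Denominators of convergents *)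

Lemma irrational_neq_IZR (x : R) (n : Z) : irrational x -> x <> IZR n.
Proof. by move=> Hx E; apply: Hx; exists n, 1%Z; split=> //; rewrite E; lra. Qed.

Lemma irrational_frac_inv (x : R) : irrational x -> irrational (fracR (1 / x)).
Proof.
move=> Hx [p [q [q0 E]]].
have x0 : x <> 0 := irrational_neq_IZR (n := 0) Hx.
have q0' : IZR q <> 0 by exact: not_0_IZR.
have [n En] := fracR_shift (1 / x); rewrite E in En.
have Ex : x * IZR (p + n * q) = IZR q.
  rewrite plus_IZR mult_IZR.
  have -> : IZR p + IZR n * IZR q = (IZR p / IZR q + IZR n) * IZR q by field.
  by rewrite -En; field.
have d0 : IZR (p + n * q) <> 0 by move=> d0; apply: q0'; rewrite -Ex d0; lra.
apply: Hx; exists q, (p + n * q)%Z; split; first by move=> d; apply: d0; rewrite d.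
by rewrite -Ex; field.
Qed.

Section Convergents.
Variable alpha : R.
Hypothesis alpha_bounds : 0 < alpha < 1 / 2.
Hypothesis alpha_irr : irrational alpha.

Lemma cf_rem_irr (k : nat) : irrational (cf_rem alpha k).
Proof. by elim: k => [|k IH] //=; apply: irrational_frac_inv. Qed.

Lemma cf_rem_bounds (k : nat) : 0 < cf_rem alpha k < 1.
Proof.
have := irrational_neq_IZR (n := 0) (@cf_rem_irr k).
by case: k => [|k] /=; [lra | have := fracR_bounds (1 / cf_rem alpha k); lra].
Qed.

Lemma pq_bounds (k : nat) :
  (0 < pq alpha k.+1)%N /\ 1 / cf_rem alpha k = INR (pq alpha k.+1) + cf_rem alpha k.+1.
Proof.
have Hr := cf_rem_bounds k; rewrite /= /fracR; set z := 1 / cf_rem alpha k.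
have z1 : 1 < z.
  by rewrite /z /Rdiv Rmult_1_l -[1]Rinv_1; apply: Rinv_lt_contravar; lra.
have [H1 H2] := base_Int_part z.
have : (0 < Int_part z)%Z by apply: lt_IZR; lra.
by move=> H0; split; [lia | rewrite INR_IZR_INZ Z2Nat.id; [lra | lia]].
Qed.

(* [theta k] is the distance [|q_k alpha - p_k|]; see [qden_approx]. *)
Fixpoint theta (k : nat) : R :=
  if k is k'.+1 then theta k' * cf_rem alpha k'.+1 else alpha.

Lemma theta_gt0 (k : nat) : 0 < theta k.
Proof. by elim: k => [|k IH] /=; [lra | have /= := cf_rem_bounds k.+1; nra]. Qed.

Lemma theta_anti (i j : nat) : (i <= j)%N -> theta j <= theta i.
Proof.
move=> /subnKC <-; elim: (j - i)%N => [|d IH]; first by rewrite addn0; lra.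
rewrite addnS /=; have /= := cf_rem_bounds (i + d).+1; have := theta_gt0 (i + d); nra.
Qed.

Lemma theta1 : theta 1 = 1 - INR (pq alpha 1) * alpha.
Proof.
have E : 1 / alpha = INR (pq alpha 1) + cf_rem alpha 1 := proj2 (pq_bounds 0).
have -> : theta 1 = alpha * cf_rem alpha 1 by [].
have -> : cf_rem alpha 1 = 1 / alpha - INR (pq alpha 1) by lra.
by field; lra.
Qed.

(** Euclid's algorithm on the distances, with the quotients that also build the denominators. *)
Lemma thetaSS (k : nat) : theta k = INR (pq alpha k.+2) * theta k.+1 + theta k.+2.
Proof.
have [_ E] := pq_bounds k.+1; have Hr := cf_rem_bounds k.+1.
have -> : theta k.+2 = theta k.+1 * cf_rem alpha k.+2 by [].
have -> : theta k.+1 = theta k * cf_rem alpha k.+1 by [].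
have -> : cf_rem alpha k.+2 = 1 / cf_rem alpha k.+1 - INR (pq alpha k.+2) by lra.
by field; lra.
Qed.

Lemma qdenSS (k : nat) :
  qden alpha k.+2 = (pq alpha k.+2 * qden alpha k.+1 + qden alpha k)%N.
Proof. by rewrite /qden; case E : (q_pair alpha k) => [a b] /=; rewrite E. Qed.

Lemma qden1 : qden alpha 1 = pq alpha 1.
Proof. by rewrite /qden /=; lia. Qed.

Lemma qden_gt0 (k : nat) : (0 < qden alpha k)%N.
Proof.
suff : (0 < qden alpha k)%N /\ (0 < qden alpha k.+1)%N by case.
elim: k => [|k [IH1 IH2]]; first by rewrite qden1; split=> //; have [] := pq_bounds 0.
by split=> //; rewrite qdenSS; lia.
Qed.

Lemma qden_leq (i j : nat) : (i <= j)%N -> (qden alpha i <= qden alpha j)%N.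
Proof.
move=> /subnKC <-; elim: (j - i)%N => [|d IH]; first by rewrite addn0.
rewrite addnS; apply: leq_trans IH _; case: (i + d)%N => [|k].
  by rewrite qden1; have [] := pq_bounds 0.
by rewrite qdenSS; have [H _] := pq_bounds k.+1; nia.
Qed.

(** With alternating signs, the recurrence of the denominators turns into [thetaSS]. *)
Lemma qden_approx (k : nat) :
  exists P : Z, INR (qden alpha k) * alpha - IZR P = (-1) ^ k * theta k.
Proof.
suff : (exists P : Z, INR (qden alpha k) * alpha - IZR P = (-1) ^ k * theta k) /\
  (exists P : Z, INR (qden alpha k.+1) * alpha - IZR P = (-1) ^ k.+1 * theta k.+1) by case.
elim: k => [|k [[P HP] [P' HP']]].
  split; first by exists 0%Z; rewrite /qden /=; lra.
  by exists 1%Z; rewrite qden1 theta1 /=; lra.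
split; first by exists P'.
exists (Z.of_nat (pq alpha k.+2) * P' + P)%Z.
rewrite qdenSS plus_IZR mult_IZR -INR_IZR_INZ plus_INR mult_INR.
have -> : theta k.+2 = theta k - INR (pq alpha k.+2) * theta k.+1 by have := thetaSS k; lra.
by move: HP HP'; rewrite /=; nra.
Qed.

(** As [theta k <= alpha < 1/2], the integer found in [qden_approx] is the nearest one. *)
Lemma qden_dist (k : nat) (c : Z) : theta k <= Rabs (INR (qden alpha k) * alpha - IZR c).
Proof.
have [P E] := qden_approx k.
have t0 := theta_gt0 k; have ta : theta k <= alpha := theta_anti (leq0n k).
have -> : INR (qden alpha k) * alpha - IZR c = (-1) ^ k * theta k + IZR (P - c).
  by rewrite minus_IZR; lra.
have s1 : (-1) ^ k = 1 \/ (-1) ^ k = -1.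
  by elim: k {E t0 ta P} => [|k [] IH] /=; rewrite ?IH; [left | right | left]; lra.
have : (P - c = 0 \/ P - c <= -1 \/ 1 <= P - c)%Z by lia.
case=> [->|[/IZR_le H|/IZR_le H]]; rewrite /Rabs; case: Rcase_abs; case: s1 => ->; lra.
Qed.

(** * Slopes with a large partial quotient *)

Lemma short_of_qden_period (y : R) (w : seq bool) (i k E : nat) :
  near_line alpha y w -> (i <= k)%N -> 1 < INR E.+1 * theta k ->
  abelian_period w (qden alpha i) -> (size w + 2 <= (E + 2) * qden alpha k)%N.
Proof.
move=> Hl ik HE /(abelian_period_drift Hl) [e [c [e0 _ Hs Hec]]].
have Hd := qden_dist i (Z.of_nat c); rewrite -INR_IZR_INZ in Hd.
have Hk := theta_anti ik; have k0 := theta_gt0 k.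
have e0' := pos_INR e.
(* Every block drifts by at least [theta i >= theta k], so more than [E] blocks would leave the
   strip. *)
have eE : (e <= E)%N.
  have : INR e < INR E.+1.
    by apply: (Rmult_lt_reg_r (theta k)) => //; nra.
  by move/INR_lt; lia.
by apply: leq_trans Hs _; apply: leq_mul; [lia | exact: qden_leq].
Qed.

(* Blocks of length [2 q_(k+1)] are no worse than pairs of blocks of length
   [q_(k+1)], but head and tail may have up to [2 q_(k+1) - 1] letters, so the
   word can be made longer than any word of period [q_i], [i <= k+1]. *)
Lemma large_pq_bad_word (k : nat) : (1 < pq alpha k.+2)%N ->
  exists w, [/\ w <> [::], factor_of_slope alpha w &
    forall p i, min_abelian_period w p -> p <> qden alpha i].
Proof.
move=> Hpq; set q := qden alpha k.+1.
have q0 : (0 < q)%N := qden_gt0 k.+1.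
set th := theta k.+1; have th0 : 0 < th := theta_gt0 k.+1.
have [P EP] := qden_approx k.+1; rewrite -/q -/th in EP.
have th2 : 2 * th < alpha.
  have := thetaSS k; have := theta_anti (leq0n k); have := theta_gt0 k.+2.
  have : 2 <= INR (pq alpha k.+2) by apply: (le_INR 2); lia.
  rewrite -/th /=; nra.
have q2 : (2 * q < qden alpha k.+2)%N.
  by rewrite qdenSS -/q; have := qden_gt0 k; nia.
(* [E] is the integer part of 1 / th. The first inequality is strict because [E th = 1] would make
   [alpha] rational. *)
have [E [E1 E2]] : exists E : nat, INR E * th < 1 /\ 1 < INR E.+1 * th.
  have [H1 H2] := base_Int_part (1 / th).
  have z0 : 0 < 1 / th by apply: Rdiv_lt_0_compat; lra.
  have i0 : (-1 < Int_part (1 / th))%Z by apply: lt_IZR; lra.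
  exists (Z.to_nat (Int_part (1 / th))); rewrite S_INR INR_IZR_INZ Z2Nat.id; last by lia.
  set m := Int_part _ in H1 H2 i0 *.
  have Ez : 1 / th * th = 1 by field; lra.
  split; last by nra.
  suff : IZR m * th <> 1 by nra.
  move=> Em; apply: alpha_irr.
  have m0 : m <> 0%Z by move=> m0; rewrite m0 in Em; lra.
  have [s Es] : exists s, (-1) ^ k.+1 = IZR s.
    by exists ((-1) ^ Z.of_nat k.+1)%Z; rewrite -pow_IZR.
  exists (m * P + s)%Z, (m * Z.of_nat q)%Z; split; first by nia.
  rewrite plus_IZR !mult_IZR -INR_IZR_INZ -Es.
  have : IZR m * (INR q * alpha - IZR P) = (-1) ^ k.+1.
    have -> : IZR m * (INR q * alpha - IZR P) = (-1) ^ k.+1 * (IZR m * th) by rewrite EP; ring.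
    by rewrite Em; ring.
  move=> Ek; rewrite -Ek; field; split; last by apply: not_0_IZR.
  by apply: not_0_INR; lia.
pose e := (E %/ 2)%N.
have e2 : (2 * e <= E <= 2 * e + 1)%N by rewrite /e; lia.
have e0 : (0 < e)%N.
  suff : (1 < E)%N by lia.
  have : INR 1 < INR E.
    apply: Rnot_le_lt => /= HE; rewrite S_INR in E2; nra.
  by move/INR_lt; lia.
pose D := (-1) ^ k.+1 * th.
have eD : Rabs (INR e * D) < 1 / 2.
  rewrite Rabs_mult /D Rabs_mult pow_1_abs Rmult_1_l (Rabs_pos_eq _ (pos_INR e)).
  rewrite (Rabs_pos_eq th); last by lra.
  have : INR (2 * e) <= INR E by apply: le_INR; lia.
  by rewrite mult_INR /=; nra.
have aD : Rabs D = th.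
  by rewrite /D Rabs_mult pow_1_abs Rmult_1_l Rabs_pos_eq //; lra.
have {}eD : - (1 / 2) < INR e * D < 1 / 2 by apply Rabs_def2 in eD; lra.
(* The longest possible head. With this [t], the [e] drifts of [2 D] lead from [1/2 - e D] to
   [1/2 + e D], inside (0, 1). The word also gets the longest possible tail. *)
pose h := (2 * q - 1)%N.
pose t := 1 / 2 - INR e * D.
have [m0 Em] := fracR_shift (t - INR h * alpha).
set rho := fracR _ in Em.
have [w [Hs Hf Hl]] := @sturm_word alpha rho (e * (2 * q) + 4 * q - 2) ltac:(lra) (fracR_bounds _).
have Hp : abelian_period w (2 * q).
  have Ed : INR (2 * q) * alpha - IZR (2 * P) = 2 * D.
    by rewrite mult_INR mult_IZR /=; rewrite /D -EP; lra.
  have Ea : Rabs (2 * D) = 2 * th by rewrite Rabs_mult aD Rabs_pos_eq; lra.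
  apply: (@abelian_period_of_drift alpha rho w (2 * q) h e (2 * P) (- m0) t Hl);
    rewrite ?Ed ?Ea ?Hs /h ?opp_IZR; try lra; try lia.
  by rewrite -/h; lra.
  by rewrite /t; lra.
  by rewrite /t; lra.
exists w; split=> //.
  by move=> w0; move: Hs; rewrite w0 /=; lia.
move=> p i [pp pmin] Ei.
have ik : (i <= k.+1)%N.
  rewrite leqNgt; apply/negP => ki.
  by have := pmin _ Hp; have := qden_leq ki; lia.
(* Here [size w + 2] is [(2 e + 4) q], while [E <= 2 e + 1] allows at most [(2 e + 3) q]. *)
rewrite Ei in pp; have := short_of_qden_period Hl ik E2 pp.
by rewrite Hs -/q; nia.
Qed.

Lemma large_pq1_bad_word : (2 < pq alpha 1)%N ->
  exists w, [/\ w <> [::], factor_of_slope alpha w &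
    forall p i, min_abelian_period w p -> p <> qden alpha i].
Proof.
move=> Hpq; exists [:: false; true]; split=> //.
  (* The orbit goes from 1 - 2 alpha, in I_0, to 1 - alpha, the left end of I_1. *)
  exists (1 - 2 * alpha), false, 0%N; split; first by lra.
  have E i r : 0 <= r < 1 -> 1 - 2 * alpha + INR i * alpha = r ->
      fracR (1 - 2 * alpha + INR i * alpha) = r.
    by move=> Hr Er; apply: (@fracR_unique _ _ 0); rewrite ?Er //; lra.
  case=> [|[|//]] _; rewrite /sturm_letter /in_I0 /=.
    by rewrite (E 0%N (1 - 2 * alpha)) /=; [split=> // _; lra | lra | lra].
  by rewrite (E 1%N (1 - alpha)) /=; [split=> //; lra | lra | lra].
move=> p i [pp pmin] Ei.
have p2 : (p <= 2)%N by apply: (pmin 2%N); apply/abperiodP.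
have i0 : (i < 1)%N.
  rewrite ltnNge; apply/negP => i1.
  by have := qden_leq i1; rewrite qden1 -Ei; lia.
have Ep : p = 1%N by rewrite Ei; case: (i) i0.
by move: pp; rewrite Ep => /abperiodP.
Qed.

(** From index 1 on the remainders form an orbit of an expanding map that never leaves (0, 1); this
    forces the first of them to be the fixed point [x], and [1 / alpha = 2 + x]. *)
Lemma golden_of_pq : pq alpha 1 = 2%N -> (forall k, pq alpha k.+2 = 1%N) ->
  alpha = 1 / golden_ratio ^ 2.
Proof.
move=> H1 HS.
have s5 : sqrt 5 * sqrt 5 = 5 by apply: sqrt_sqrt; lra.
have s5' : 2 < sqrt 5 < 3 by have := sqrt_pos 5; nra.
pose x := (sqrt 5 - 1) / 2.
have xx : x * x = 1 - x by rewrite /x; nra.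
have x12 : 1 / 2 < x < 1 by rewrite /x; lra.
(* The map r |-> 1/r - 1 expands distances to its fixed point [x] by [1/x > 1]. *)
have step k : Rabs (cf_rem alpha k.+1 - x) <= x * Rabs (cf_rem alpha k.+2 - x).
  have [_ E] := pq_bounds k.+1; rewrite HS INR_1 in E.
  have := cf_rem_bounds k.+1; set r := cf_rem alpha k.+1 in E * => Hr.
  have -> : cf_rem alpha k.+2 = 1 / r - 1 by lra.
  have -> : r - x = - (r * (x * (1 / r - 1 - x))).
    have -> : r * (x * (1 / r - 1 - x)) = x - r * (x + x * x) by field; lra.
    by rewrite xx; lra.
  rewrite Rabs_Ropp (Rabs_mult r) (Rabs_mult x) (Rabs_pos_eq r); last by lra.
  rewrite (Rabs_pos_eq x); last by lra.
  have : 0 <= x * Rabs (1 / r - 1 - x) by apply: Rmult_le_pos; [lra | exact: Rabs_pos].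
  by nra.
have small n : Rabs (cf_rem alpha 1 - x) <= x ^ n.
  have : Rabs (cf_rem alpha 1 - x) <= x ^ n * Rabs (cf_rem alpha n.+1 - x).
    elim: n => [|n IH]; first by rewrite /=; lra.
    have := step n; have := pow_lt x n ltac:(lra).
    by rewrite [x ^ n.+1]/=; nra.
  have : Rabs (cf_rem alpha n.+1 - x) <= 1.
    by have := cf_rem_bounds n.+1 => H; apply: Rabs_le; lra.
  by have := pow_lt x n ltac:(lra); nra.
have Ex : cf_rem alpha 1 = x.
  case: (Req_dec (cf_rem alpha 1) x) => // Hne; exfalso.
  have d0 := Rabs_pos_lt _ (Rminus_eq_contra _ _ Hne).
  have [|N HN] := pow_lt_1_zero x _ (Rabs (cf_rem alpha 1 - x)) d0.
    by rewrite Rabs_pos_eq; lra.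
  have := HN N (Nat.le_refl N); rewrite Rabs_pos_eq; last by apply: pow_le; lra.
  by have := small N; lra.
have E : 1 / alpha = INR (pq alpha 1) + cf_rem alpha 1 := proj2 (pq_bounds 0).
rewrite H1 Ex /= in E.
have Ea : alpha * (2 + x) = 1 by have <- : 1 / alpha = 2 + x; [lra | field; lra].
have Eg : golden_ratio ^ 2 = 2 + x by rewrite /golden_ratio /x; nra.
by rewrite Eg -Ea; field; lra.
Qed.

End Convergents.

(** * The golden slope *)

(* [381 / 1000 < 1 / golden_ratio ^ 2 < 382 / 1000] *)
Fixpoint in_strip (d c : Z) (w : seq bool) : bool :=
  if ((c * 1000 <=? 1000 + d * 382) && (d * 381 - 1000 <=? c * 1000))%Z
  then if w is b :: w' then in_strip (d + 1)%Z (if b then (c + 1)%Z else c) w' else true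
  else false.

(** Words grow at the front: a suffix of a word in a strip is again in a strip, so filtering at
    every length loses no such word. *)
Fixpoint strip_words (n : nat) : seq (seq bool) :=
  if n is n'.+1 then
    let W := strip_words n' in
    filter (in_strip 0 0) (map (cons false) W ++ map (cons true) W)
  else [:: [::]].

(** The list holds the non-Fibonacci numbers below 13. *)
Definition fib_period_check (w : seq bool) : bool :=
  all (fun p => if abperiodb w p then has (abperiodb w) (iota 0 p) else true)
    [:: 4; 6; 7; 9; 10; 11; 12]%N.

Lemma fib_period_check_strip_words :
  all (fun n => all fib_period_check (strip_words n)) (iota 0 16).
Proof. by vm_compute. Qed.

(** Indexed from 1, 2 to match the denominators of the golden slope; see [qden_golden]. *)
Fixpoint fibs (k : nat) : nat :=
  match k with
  | 0 => 1
  | 1 => 2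
  | (k''.+1 as k').+1 => (fibs k' + fibs k'')%N
  end.

Lemma fibsSS (k : nat) : fibs k.+2 = (fibs k.+1 + fibs k)%N.
Proof. by []. Qed.

Lemma fibs_bounds (k : nat) : (0 < fibs k < fibs k.+1)%N /\ (fibs k.+1 <= 2 * fibs k)%N.
Proof. by elim: k => [|k IH] //; rewrite fibsSS; lia. Qed.

(** The ratio evolves by r -> 1 + 1/r, which reverses order; so the upper bound 13/8 is proved
    together with the lower bound 21/13. *)
Lemma fibs_ratio (k : nat) : (8 * fibs (k + 4).+1 <= 13 * fibs (k + 4))%N.
Proof.
suff : (8 * fibs (k + 4).+1 <= 13 * fibs (k + 4))%N /\ (21 * fibs (k + 4) <= 13 * fibs (k + 4).+1)%N
  by case.
by elim: k => [|k IH] //; rewrite addSn fibsSS; lia.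
Qed.

Lemma leq_fibs (k : nat) : (k < fibs k)%N.
Proof. by elim: k => [|k IH] //; have := fibs_bounds k; lia. Qed.

Lemma fibs_between (p : nat) : (0 < p)%N -> exists k, (fibs k <= p < fibs k.+1)%N.
Proof.
move=> p0; have ex : exists k, (p < fibs k.+1)%N.
  by exists p; have := leq_fibs p.+1; lia.
case: (ex_minnP ex) => k Hk Hmin; exists k; rewrite Hk andbT.
case: k Hk Hmin => [|k] Hk Hmin //; rewrite leqNgt; apply/negP => /Hmin; lia.
Qed.

Section Golden.
Variable x : R.
Hypothesis x_eq : x * x = 1 - x.
Hypothesis x_bounds : 618 / 1000 < x < 619 / 1000.
Let alpha : R := 1 - x.

Lemma near_line_strip_words (y : R) (w : seq bool) :
  near_line alpha y w -> w \in strip_words (size w).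
Proof.
move=> Hl.
have ok v z i u : near_line alpha z v -> (i <= size v)%N -> u = drop i v ->
    in_strip (Z.of_nat i) (Z.of_nat (ones v i)) u.
  move=> Hz.
  have z01 : 0 <= z <= 1 by have := Hz 0%N isT; rewrite /ones take0 /=; lra.
  have lo_hi m : (m <= size v)%N ->
      ((Z.of_nat (ones v m) * 1000 <=? 1000 + Z.of_nat m * 382)
        && (Z.of_nat m * 381 - 1000 <=? Z.of_nat (ones v m) * 1000))%Z.
    move=> Hm; have := Hz m Hm; rewrite !INR_IZR_INZ /alpha => Hzm.
    have m0 : 0 <= IZR (Z.of_nat m) by apply: IZR_le; lia.
    by apply/andP; split; apply/Z.leb_le; apply: le_IZR;
      rewrite ?minus_IZR ?plus_IZR !mult_IZR; nra.
  elim: u i => [|b u IH] i Hi Eu /=; rewrite lo_hi //.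
  have iv : (i < size v)%N.
    by have := size_drop i v; rewrite -Eu /=; lia.
  rewrite (drop_nth false iv) in Eu; case: Eu => Eb Eu; rewrite /=.
  have := IH i.+1 iv Eu; rewrite onesS // -Eb.
  have -> : (Z.of_nat i + 1)%Z = Z.of_nat i.+1 by lia.
  suff -> : (if b then (Z.of_nat (ones v i) + 1)%Z else Z.of_nat (ones v i)) =
    Z.of_nat (ones v i + b) by [].
  by case: (b); lia.
elim: w y Hl => [|b w IH] y Hl //; rewrite [size _]/= [strip_words _]/= mem_filter.
apply/andP; split.
  by have := ok _ _ 0%N (b :: w) Hl isT (esym (drop0 _)).
have Hw : w \in strip_words (size w).
  (* Removing the first letter [b] moves the intercept to [y + alpha - b]. *)
  apply: (IH (y + alpha - INR b)) => i Hi; have := Hl i.+1 Hi.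
  by rewrite /ones /= plus_INR -/(INR i.+1) S_INR; lra.
by rewrite mem_cat; case: (b); rewrite map_f ?orbT.
Qed.

Lemma short_min_period (y : R) (w : seq bool) (p : nat) :
  near_line alpha y w -> (size w <= 15)%N -> min_abelian_period w p ->
  p \notin [:: 4; 6; 7; 9; 10; 11; 12]%N.
Proof.
move=> Hl Hs [/abperiodP Hp Hmin]; apply/negP => Hin.
have := allP fib_period_check_strip_words (size w); rewrite mem_iota => /(_ Hs).
move/allP/(_ _ (near_line_strip_words Hl))/allP/(_ _ Hin); rewrite Hp => /hasP [r].
by rewrite mem_iota => Hr /abperiodP/Hmin; lia.
Qed.

(* The difference between [fibs k * alpha] and the nearest integer. *)
Definition drift (k : nat) : R := (- x) ^ k * (1 - x).

Lemma driftSS (k : nat) : drift k.+2 = drift k.+1 + drift k.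
Proof.
rewrite /drift /=; have -> : - x * (- x * (- x) ^ k) = (x * x) * (- x) ^ k by ring.
by rewrite x_eq; ring.
Qed.

Lemma drift_abs (k : nat) : Rabs (drift k) = x ^ k.+2.
Proof.
rewrite /drift -x_eq Rabs_mult -RPow_abs Rabs_Ropp !Rabs_pos_eq; [by rewrite /=; ring | nra | nra].
Qed.

Lemma drift_sign (k : nat) : drift k = x ^ k.+2 \/ drift k = - x ^ k.+2.
Proof. rewrite -drift_abs /Rabs; case: Rcase_abs => _; [right | left]; ring. Qed.

(** * Diophantine approximation at the golden slope *)

Lemma fibs_basis (k : nat) (m n : Z) : exists a b : Z,
  (m = a * Z.of_nat (fibs k) + b * Z.of_nat (fibs k.+1))%Z /\
  IZR m * alpha - IZR n = IZR a * drift k + IZR b * drift k.+1.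
Proof.
elim: k => [|k [a [b [E1 E2]]]].
  exists (m - 2 * n)%Z, n; split; first by rewrite [fibs 0]/= [fibs 1]/=; lia.
  have E : - x * 1 * (1 - x) = 1 - 2 * x by nra.
  by rewrite minus_IZR mult_IZR /drift /= E /alpha; ring.
(* Unimodular change of basis: replace [fibs k] by [fibs k.+2 - fibs k.+1]. *)
exists (b - a)%Z, a; rewrite fibsSS driftSS; split; first by lia.
by rewrite E2 minus_IZR; ring.
Qed.

Lemma fibs_approx (k : nat) : exists P : Z, INR (fibs k) * alpha - IZR P = drift k.
Proof.
suff : (exists P : Z, INR (fibs k) * alpha - IZR P = drift k) /\
  (exists P : Z, INR (fibs k.+1) * alpha - IZR P = drift k.+1) by case.
elim: k => [|k [[P HP] [P' HP']]].
  split; first by exists 0%Z; rewrite /drift /alpha /=; ring.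
  by exists 1%Z; rewrite /drift /alpha /=; nra.
split; first by exists P'.
by exists (P' + P)%Z; rewrite driftSS fibsSS plus_INR plus_IZR -HP -HP'; ring.
Qed.

(** In the basis [fibs k], [fibs k.+1], the position of [p] forces coordinates of opposite signs, or
    [b = 0] and [a >= 2]. Consecutive drifts also have opposite signs, so nothing cancels: the
    distance is at least [1 + x = 1 / x] times that of [fibs k]. *)
Lemma dist_between_fibs (k p : nat) (n : Z) : (fibs k.+1 < p < fibs k.+2)%N ->
  x ^ k.+1 <= Rabs (INR p * alpha - IZR n).
Proof.
move=> /andP[H1 H2]; have [a [b [E1 E2]]] := fibs_basis k (Z.of_nat p) n.
rewrite INR_IZR_INZ E2.
have -> : IZR a * drift k + IZR b * drift k.+1 = drift k * (IZR a - IZR b * x).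
  by rewrite /drift /=; ring.
rewrite Rabs_mult drift_abs.
have xk : 0 < x ^ k by apply: pow_lt; lra.
have -> : x ^ k.+1 = x ^ k.+2 * (1 + x).
  rewrite /=; have -> : x * (x * x ^ k) * (1 + x) = x * x ^ k * (x + x * x) by ring.
  by rewrite x_eq; ring.
apply: Rmult_le_compat_l; first by rewrite /=; nra.
have [/andP[f0 f1] f2] := fibs_bounds k; rewrite fibsSS in H2.
have [[Ha Hb]|[[Ha Hb]|[Ha Hb]]] :
  ((1 <= a /\ b <= -1) \/ (2 <= a /\ b = 0) \/ (a <= -1 /\ 1 <= b))%Z.
- have : (a <= -1 \/ a = 0 \/ a = 1 \/ 2 <= a)%Z by lia.
  have : (b <= -1 \/ b = 0 \/ b = 1 \/ 2 <= b)%Z by lia.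
  by nia.
- have {}Ha := IZR_le _ _ Ha; have {}Hb := IZR_le _ _ Hb.
  by rewrite /Rabs; case: Rcase_abs; nra.
- have {}Ha := IZR_le _ _ Ha; rewrite Hb.
  by rewrite /Rabs; case: Rcase_abs; nra.
- have {}Ha := IZR_le _ _ Ha; have {}Hb := IZR_le _ _ Hb.
  by rewrite /Rabs; case: Rcase_abs; nra.
Qed.

(* Among the multiples [h alpha] with [h < fibs k.+1], replacing [h] by
   [h + fibs k] or by [h + fibs k - fibs k.+1] always moves in the same direction,
   by [x ^ k.+2] or [x ^ k.+1]. *)
Lemma fibs_gap (y a : R) (k : nat) : exists (h : nat) (n : Z),
  (h < fibs k.+1)%N /\ a <= y + INR h * alpha - IZR n <= a + x ^ k.+1.
Proof.
have [/andP[f0 f1] f2] := fibs_bounds k.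
have xk : 0 < x ^ k by apply: pow_lt; lra.
have [P EP] := fibs_approx k; have [P' EP'] := fibs_approx k.+1.
have ED : drift k.+1 = - x * drift k by rewrite /drift /=; ring.
(* The factor [s], which will be 1 or -1, makes every move go upwards. *)
have next s h n : s * drift k = x ^ k.+2 -> (h < fibs k.+1)%N ->
    exists h' n', (h' < fibs k.+1)%N /\
      s * (y + INR h * alpha - IZR n) + x ^ k.+2 <= s * (y + INR h' * alpha - IZR n')
        <= s * (y + INR h * alpha - IZR n) + x ^ k.+1.
  move=> Es Hh; case: (ltnP (h + fibs k) (fibs k.+1)) => Hhf.
    exists (h + fibs k)%N, (n + P)%Z; split=> //.
    rewrite plus_INR plus_IZR.
    have -> : s * (y + (INR h + INR (fibs k)) * alpha - (IZR n + IZR P)) =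
      s * (y + INR h * alpha - IZR n) + s * drift k by rewrite -EP; ring.
    by rewrite Es /=; nra.
  exists (h + fibs k - fibs k.+1)%N, (n + P - P')%Z; split; first by lia.
  rewrite minus_INR; last by lia.
  rewrite plus_INR minus_IZR plus_IZR.
  have -> : s * (y + (INR h + INR (fibs k) - INR (fibs k.+1)) * alpha - (IZR n + IZR P - IZR P')) =
    s * (y + INR h * alpha - IZR n) + s * drift k * (1 + x).
    have -> : s * drift k * (1 + x) = s * (drift k - drift k.+1) by rewrite ED; ring.
    by rewrite -EP -EP'; ring.
  rewrite Es; have -> : x ^ k.+2 * (1 + x) = x ^ k.+1.
    rewrite /=; have -> : x * (x * x ^ k) * (1 + x) = x * x ^ k * (x + x * x) by ring.
    by rewrite x_eq; ring.
  by rewrite /=; nra.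
(* Start below [b] at [h = 0]. Each move gains at least [x ^ k.+2], so [b] is reached, and the
   crossing move overshoots by at most [x ^ k.+1]. *)
have climb s b : s * drift k = x ^ k.+2 -> s * s = 1 ->
    exists (h : nat) (n : Z), (h < fibs k.+1)%N /\
      b <= s * (y + INR h * alpha - IZR n) <= b + x ^ k.+1.
  move=> Es ss.
  have iter N h n : (h < fibs k.+1)%N -> s * (y + INR h * alpha - IZR n) <= b ->
      b - s * (y + INR h * alpha - IZR n) <= INR N * x ^ k.+2 ->
      exists (h : nat) (n : Z), (h < fibs k.+1)%N /\
        b <= s * (y + INR h * alpha - IZR n) <= b + x ^ k.+1.
    elim: N h n => [|N IH] h n Hh H1 H2.
      exists h, n; split=> //; rewrite [INR 0]/= in H2.
      by have := pow_lt x k.+1 ltac:(lra); lra.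
    have [h' [n' [Hh' Hn']]] := next s h n Es Hh.
    case: (Rle_dec b (s * (y + INR h' * alpha - IZR n'))) => Hb.
      by exists h', n'; split=> //; lra.
    by apply: (IH h' n') => //; rewrite ?S_INR in H2 *; lra.
  have [n Hn] : exists n : Z, s * (y - IZR n) <= b.
    have [H1 H2] := archimed (s * (s * y - b)).
    have [H3 H4] := archimed (- (s * (s * y - b))).
    have : s = 1 \/ s = -1 by have : (s - 1) * (s + 1) = 0 by [nra]; move=> /Rmult_integral; lra.
    case=> s1; rewrite s1 in H1 H2 H3 H4 *; first by exists (up (1 * (1 * y - b))); lra.
    by exists (- up (- (-1 * (-1 * y - b))))%Z; rewrite opp_IZR; lra.
  have [N HN] := INR_unbounded ((b - s * (y - IZR n)) / x ^ k.+2).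
  apply: (iter N 0%N n); rewrite ?[INR 0]/=; try lia; try lra.
  have xk2 : 0 < x ^ k.+2 by apply: pow_lt; lra.
  move/(Rmult_lt_compat_r _ _ _ xk2): HN; rewrite /Rdiv Rmult_assoc Rinv_l; last by lra.
  by lra.
case: (drift_sign k) => Ed.
  have [||h [n [Hh Hn]]] := @climb 1 a; [by lra | by lra |].
  by exists h, n; split=> //; lra.
have [||h [n [Hh Hn]]] := @climb (-1) (- a - x ^ k.+1); [by lra | by lra |].
by exists h, n; split=> //; lra.
Qed.

(** Divided by [fibs k.+1], the last hypothesis says that the total drift of the blocks plus the gap
    of [fibs_gap] is below 1; so some head shorter than a block keeps all block boundaries inside
    (0, 1). Length [2 * fibs k.+1] leaves a full block after it. *)
Lemma fibs_period (y : R) (w : seq bool) (k : nat) :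
  near_line alpha y w -> (2 * fibs k.+1 <= size w)%N ->
  INR (size w) * x ^ k.+3 + INR (fibs k.+1) * x ^ k.+1 < INR (fibs k.+1) ->
  abelian_period w (fibs k.+1).
Proof.
move=> Hl HL Hsmall; set q := fibs k.+1 in HL Hsmall *.
have q0 : (0 < q)%N by have := fibs_bounds k.+1; lia.
have q0' : 0 < INR q by apply: lt_0_INR; lia.
have [P EP] := fibs_approx k.+1; rewrite -/q in EP.
pose E := INR (size w) / INR q.
have HE : E * x ^ k.+3 + x ^ k.+1 < 1.
  apply: (Rmult_lt_reg_r (INR q)) => //; rewrite Rmult_1_l.
  suff -> : (E * x ^ k.+3 + x ^ k.+1) * INR q =
    INR (size w) * x ^ k.+3 + INR q * x ^ k.+1 by [].
  by rewrite /E; field; lra.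
have xk3 : 0 < x ^ k.+3 by apply: pow_lt; lra.
have x3 : x ^ k.+3 <= 1 - x.
  have : x ^ k.+1 <= 1 by rewrite -(pow1 k.+1); apply: pow_incr; lra.
  by rewrite -x_eq [x ^ k.+3]/= -/(x ^ k.+1) /=; nra.
have Da : Rabs (drift k.+1) = x ^ k.+3 := drift_abs k.+1.
set slack := 1 - E * x ^ k.+3 - x ^ k.+1.
have sl0 : 0 < slack by rewrite /slack; lra.
(* The window for [t] lies at the end of (0, 1) that the drift moves away from, with half the slack
   as margin on each side. *)
have [a Ha] : exists a, forall t eR, a <= t <= a + x ^ k.+1 -> 0 <= eR <= E ->
    0 < t < 1 /\ 0 < t + eR * drift k.+1 < 1.
  case: (drift_sign k.+1) => Ed; rewrite Ed.
    by exists (slack / 2) => t eR Ht HeR; rewrite /slack in sl0 Ht *; nra.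
  by exists (E * x ^ k.+3 + slack / 2) => t eR Ht HeR; rewrite /slack in sl0 Ht *; nra.
have [h [n [Hh Hn]]] := fibs_gap y a k; rewrite -/q in Hh.
pose e := ((size w - h) %/ q)%N.
have e0 : (0 < e)%N by rewrite divn_gt0 //; lia.
have Heq : (e * q <= size w - h < e.+1 * q)%N.
  by rewrite leq_trunc_div ltn_ceil.
have HeE : 0 <= INR e <= E.
  split; first exact: pos_INR.
  apply: (Rmult_le_reg_r (INR q)) => //; rewrite /E -mult_INR.
  have -> : INR (size w) / INR q * INR q = INR (size w) by field; lra.
  by apply: le_INR; lia.
have [H1 H2] := Ha _ _ Hn HeE.
have a01 : 0 < alpha < 1 by rewrite /alpha; lra.
have x3' : x ^ k.+3 <= alpha /\ x ^ k.+3 <= 1 - alpha by rewrite /alpha; lra.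
by apply: (@abelian_period_of_drift alpha y w q h e P n (y + INR h * alpha - IZR n) Hl);
  rewrite ?EP ?Da //; try lra; try lia.
Qed.

(** * Minimum periods at the golden slope *)

Lemma min_period_fibs (y : R) (w : seq bool) (p : nat) :
  near_line alpha y w -> min_abelian_period w p -> exists k, p = fibs k.
Proof.
move=> Hl [Hp Hmin].
have [e [c [e0 HpL HL He]]] := abelian_period_drift Hl Hp.
have p0 : (0 < p)%N by case: (p) HL; lia.
have [k /andP[K1 K2]] := fibs_between p0.
case: (eqVneq p (fibs k)) => [->|Hne]; first by exists k.
exfalso; have {}K1 : (fibs k < p)%N by lia.
have notper r : (r < p)%N -> ~ abelian_period w r by move=> Hr /Hmin; lia.
case: k K1 K2 {Hne} => [|k] K1 K2; first by rewrite /= in K1 K2; lia.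
have Hd := @dist_between_fibs k p (Z.of_nat c) ltac:(lia).
rewrite -INR_IZR_INZ in Hd.
have eX : INR e * x ^ k.+1 <= 1 by have := pos_INR e; nra.
have x2 : x ^ 2 = 1 - x by rewrite /= -x_eq; ring.
have x3 : x ^ 3 = 2 * x - 1.
  have -> : x ^ 3 = x * x ^ 2 by ring.
  by rewrite x2; nra.
have x4 : x ^ 4 = 2 - 3 * x.
  have -> : x ^ 4 = x * x ^ 3 by ring.
  by rewrite x3; nra.
have x5 : x ^ 5 = 5 * x - 3.
  have -> : x ^ 5 = x * x ^ 4 by ring.
  by rewrite x4; nra.
have small j i : (i <= j)%N -> 0 < x ^ j <= x ^ i.
  move=> /subnKC <-; rewrite pow_add; split.
    by apply: Rmult_lt_0_compat; apply: pow_lt; lra.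
  have : x ^ (j - i) <= 1 by rewrite -(pow1 (j - i)); apply: pow_incr; lra.
  by have := pow_lt x i ltac:(lra); nra.
have HL' : INR (size w) + 2 <= (INR e + 2) * INR p.
  by have := le_INR (size w + 2) ((e + 2) * p) ltac:(lia); rewrite mult_INR !plus_INR /=; lra.
have HX := small k.+1.
have fib_vals : ((fibs 1 = 2%N) * (fibs 2 = 3%N) * (fibs 3 = 5%N) * (fibs 4 = 8%N) *
    (fibs 5 = 13%N))%type by [].
set X := x ^ k.+1 in eX HX.
have Hshort : (size w <= 15)%N -> (p < 13)%N -> False.
  move=> Hs p13; have := short_min_period Hl Hs (conj Hp Hmin); rewrite !inE => Hnot.
  have f13 j : (13 <= fibs j.+4.+1)%N.
    by elim: j => // j IH; have := fibs_bounds j.+4.+1; lia.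
  case: k K1 K2 {Hd eX HX X} => [|[|[|[|k]]]] K1 K2;
    rewrite ?fib_vals in K1 K2; [lia | lia | lia | lia |].
  by have := f13 k; lia.
(* Only 4, 6 and 7 remain for [k < 3]. Period 4 forces length at most 14; periods 6 and 7 force at
   most 40, and from 16 letters on 5 is a period. *)
case: (leqP 3 k) => k3; last first.
  case: k k3 K1 K2 @X Hd eX HX => [|[|[|//]]] _ K1 K2 X _ eX HX;
    rewrite ?fib_vals in K1 K2; rewrite /X in eX.
  - by lia.
  - have Ep : p = 4%N by lia.
    have : INR e < INR 3 by apply: Rnot_le_lt => /= H3; rewrite x2 in eX; nra.
    by move=> /INR_lt e3; apply: Hshort; lia.
  - case: (leqP (size w) 15) => Hs; first by apply: Hshort; lia.
    apply: (notper 5%N); first by lia.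
    apply: (@fibs_period y w 2 Hl); first by rewrite /=; lia.
    have : INR e < INR 5 by apply: Rnot_le_lt => /= H3; rewrite x3 in eX; nra.
    move=> /INR_lt e5; have : (size w <= 40)%N by nia.
    move=> /leP/le_INR /= Hw.
    have := x5; have := x3; rewrite /=; nra.
(* From [e X <= 1], [size w * X <= (1 + 2 X) p], and [p] is at most 13/8 of [fibs k.+1]. As
   [X <= x ^ 4], this gives [(1 + 2 X) (13/8) (382/1000) + X < 1], which yields the condition of
   [fibs_period]. *)
have [Hw|Hw] := leqP (2 * fibs k.+1) (size w).
  apply: (notper _ K1); apply: (@fibs_period y w k Hl Hw).
  have := fibs_ratio (k - 3); have -> : (k - 3 + 4 = k.+1)%N by lia.
  move=> Hr; have {}Hr : (8 * p <= 13 * fibs k.+1)%N by lia.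
  have {}Hr : 8 * INR p <= 13 * INR (fibs k.+1).
    by have := le_INR _ _ (elimT leP Hr); rewrite !mult_INR /=; lra.
  have {}HX := HX 4%N ltac:(lia); rewrite x4 in HX.
  have -> : x ^ k.+3 = X * (1 - x) by rewrite -x2 /X /=; ring.
  have p0' : 0 < INR p by apply: lt_0_INR; lia.
  have LX : INR (size w) * X <= (1 + 2 * X) * INR p.
    by have : INR (size w) * X <= (INR e + 2) * INR p * X; nra.
  rewrite -/X; set q := INR (fibs k.+1) in Hr *.
  have q0 : 0 < q by lra.
  have : INR (size w) * X <= (1 + 2 * X) * (13 / 8 * q) by nra.
  move=> LX'.
  have : INR (size w) * X * (1 - x) <= (1 + 2 * X) * (13 / 8 * q) * (382 / 1000).
    by apply: Rmult_le_compat; [have := pos_INR (size w); nra | lra | lra | lra].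
  have : q * ((1 + 2 * X) * (13 / 8) * (382 / 1000) + X) < q * 1.
    by apply: Rmult_lt_compat_l; lra.
  by lra.
case: (leqP 4 k) => k4; last first.
  have E3 : k = 3%N by lia.
  by rewrite E3 ?fib_vals in K2 Hw; apply: Hshort; lia.
(* The index drops by two: now [2 fibs k.+1 < fibs k.+3 < p], and the length is below
   [2 fibs k.+3 <= 6 fibs k.+1]. *)
case: k k4 K1 K2 Hw {Hd k3 X eX HX Hshort} => [//|[//|k]] k4 K1 K2 Hw.
have B0 := fibs_bounds k.+1; have B1 := fibs_bounds k.+2; rewrite [fibs k.+3]fibsSS in K1 Hw B1.
apply: (notper (fibs k.+1)); first by lia.
apply: (@fibs_period y w k Hl); first by lia.
have := small k.+1 3%N ltac:(lia); rewrite x3.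
have -> : x ^ k.+3 = x ^ k.+1 * (1 - x) by rewrite -x2 /=; ring.
set Y := x ^ k.+1 => HY.
have : INR (size w) <= 6 * INR (fibs k.+1).
  by have := le_INR (size w) (6 * fibs k.+1) ltac:(lia); rewrite mult_INR /=; lra.
have q0 : 0 < INR (fibs k.+1) by apply: lt_0_INR; lia.
set q := INR (fibs k.+1) in q0 *; set l := INR (size w) => Hlq.
have : l * (Y * (1 - x)) <= 6 * q * (Y * (1 - x)) by apply: Rmult_le_compat_r => //; nra.
have : Y * (6 * (1 - x) + 1) < 1 by nra.
by nra.
Qed.

End Golden.

(** * Continued fraction of the golden slope and the equivalence *)

Lemma golden_conjugate : exists x : R,
  [/\ x * x = 1 - x, 618 / 1000 < x < 619 / 1000 & 1 / golden_ratio ^ 2 = 1 - x].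
Proof.
have s5 : sqrt 5 * sqrt 5 = 5 by apply: sqrt_sqrt; lra.
have s0 := sqrt_pos 5.
exists ((sqrt 5 - 1) / 2); split; [nra | split; nra |].
rewrite /golden_ratio; apply: (Rmult_eq_reg_r (((1 + sqrt 5) / 2) ^ 2)); last by nra.
have -> : 1 / ((1 + sqrt 5) / 2) ^ 2 * ((1 + sqrt 5) / 2) ^ 2 = 1 by field; lra.
by nra.
Qed.

(** Since 1 / (1 - x) = 2 + x and 1 / x = 1 + x, the expansion is [0; 2, 1, 1, ...]. *)
Lemma qden_golden (x : R) (k : nat) :
  x * x = 1 - x -> 618 / 1000 < x < 619 / 1000 -> qden (1 - x) k = fibs k.
Proof.
move=> xx Hx.
have E1 : 1 / (1 - x) = x + IZR 2.
  apply: (Rmult_eq_reg_r (1 - x)); last by lra.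
  have -> : 1 / (1 - x) * (1 - x) = 1 by field; lra.
  by nra.
have E2 : 1 / x = x + IZR 1.
  apply: (Rmult_eq_reg_r x); last by lra.
  have -> : 1 / x * x = 1 by field; lra.
  by nra.
have rem j : cf_rem (1 - x) j.+1 = x.
  elim: j => [|j IH]; first by apply: (fracR_unique E1); lra.
  rewrite -[RHS](fracR_unique E2); last by lra.
  by rewrite -{2}IH.
have pq1 : pq (1 - x) 1 = 2%N.
  rewrite /pq; have -> // : Int_part (1 / cf_rem (1 - x) 0) = 2%Z.
  by apply: (Int_part_unique E1); lra.
have pqS j : pq (1 - x) j.+2 = 1%N.
  rewrite /pq rem; have -> // : Int_part (1 / x) = 1%Z.
  by apply: (Int_part_unique E2); lra.
suff : qden (1 - x) k = fibs k /\ qden (1 - x) k.+1 = fibs k.+1 by case.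
elim: k => [|k [IH1 IH2]]; first by rewrite qden1 pq1.
by split=> //; rewrite qdenSS pqS IH1 IH2 mul1n.
Qed.

Theorem theorem5p9 (alpha : R) :
  0 < alpha < 1 / 2 -> irrational alpha ->
  (alpha = 1 / golden_ratio ^ 2 <->
   forall w : seq bool, w <> [::] -> factor_of_slope alpha w ->
     exists p : nat,
       min_abelian_period w p /\ exists k : nat, p = qden alpha k).
Proof.
move=> Ha Hirr; split=> [Ealpha w w0 Hw | Hall].
  have [x [xx Hx Ex]] := golden_conjugate; rewrite Ex in Ealpha; subst alpha.
  have [|y Hl] := factor_near_line _ Hw; first by lra.
  have [p Hp] := min_abelian_period_exists w0; exists p; split=> //.
  have [k ->] := min_period_fibs xx Hx Hl Hp.
  by exists k; rewrite qden_golden.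
have bad : ~ exists w, [/\ w <> [::], factor_of_slope alpha w &
    forall p i, min_abelian_period w p -> p <> qden alpha i].
  by case=> w [w0 Hw Hno]; have [p [Hp [k Ek]]] := Hall w w0 Hw; apply: (Hno p k).
apply: golden_of_pq => //.
- have H1 : (pq alpha 1 <= 2)%N.
    by rewrite leqNgt; apply/negP => /(large_pq1_bad_word Ha Hirr).
  (* [theta 1 <= theta 0] reads 1 - a_1 alpha <= alpha, which excludes a_1 = 1 because alpha <
     1/2. *)
  have := theta1 Ha Hirr; have := theta_anti Ha Hirr (leq0n 1).
  rewrite [theta alpha 0]/= => H2 H3.
  have : INR 1 < INR (pq alpha 1) by rewrite INR_1; apply: Rnot_le_lt => Hle; nra.
  by move/INR_lt; lia.
- move=> k; have [H1 _] := pq_bounds Ha Hirr k.+1.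
  have : (pq alpha k.+2 <= 1)%N.
    by rewrite leqNgt; apply/negP => /(large_pq_bad_word Ha Hirr).
  by lia.
Qed.
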